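(* Let $a$ and $b$ be positive coprime integers and let $h$ be a natural number. Then $$T_3(a,b;h)=T_1(a,b;h)+\frac{2b}{a}\,T_2(a,b;h)-\frac{b^2h(h+1)(2h+1)}{6a^2}.$$
   Context: $\lfloor x\rfloor$ is the floor of $x$ and $\{x\}=x-\lfloor x\rfloor$ its fractional part. For positive coprime integers $a,b$ and a natural number $h$, $$T_1(a,b;h):=\sum_{i=1}^{h}\left\{\frac{ib}{a}\right\}^2,\qquad T_2(a,b;h):=\sum_{i=1}^{h}i\left\lfloor\frac{ib}{a}\right\rfloor,\qquad T_3(a,b;h):=\sum_{i=1}^{h}\left\lfloor\frac{ib}{a}\right\rfloor^2 .$$ *)

(* Defs.v *)
From mathcomp Require Import all_boot all_order all_algebra.

Set Implicit Arguments.
Unset Strict Implicit.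
Unset Printing Implicit Defensive.

Import Order.TTheory GRing.Theory Num.Theory.
Local Open Scope ring_scope.

Definition frac (x : rat) : rat := x - (Num.floor x)%:~R.

Definition T1 (a b h : nat) : rat :=
  \sum_(1 <= i < h.+1) frac (i%:R * b%:R / a%:R) ^+ 2.

Definition T2 (a b h : nat) : rat :=
  \sum_(1 <= i < h.+1) i%:R * (Num.floor (i%:R * b%:R / a%:R : rat))%:~R.

Definition T3 (a b h : nat) : rat :=
  \sum_(1 <= i < h.+1) (Num.floor (i%:R * b%:R / a%:R : rat))%:~R ^+ 2.

(* Main.v *)
Require Import Defs.
From mathcomp Require Import all_boot all_order all_algebra.
From mathcomp Require Import ring.
Import Order.TTheory GRing.Theory Num.Theory.
Local Open Scope ring_scope.

(** The identity holds term by term: expand the square of [frac x = x - floor x] at x = ib/a and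
    solve for the squared floor. The remaining x^2 terms add up to b^2/a^2 times the sum of the
    first h squares, whose closed form is absorbed into the induction on [h]. *)

Theorem mainTheorem3 (a b h : nat) (ha : (0 < a)%N) (hb : (0 < b)%N)
    (hab : coprime a b) :
  T3 a b h =
    T1 a b h + 2 * b%:R / a%:R * T2 a b h
    - b%:R ^+ 2 * h%:R * (h%:R + 1) * (2 * h%:R + 1) / (6 * a%:R ^+ 2).
Proof.
have a_neq0 : a%:R != 0 :> rat by rewrite pnatr_eq0 -lt0n.
elim: h => [|h IHh]; first by rewrite /T1 /T2 /T3 !big_geq //; field.
rewrite /T1 /T2 /T3 !(big_nat_recr h.+1) //= -/(T1 a b h) -/(T2 a b h).
rewrite -/(T3 a b h) IHh /Defs.frac.
(* With x = i b / a the inductive step is floor(x)^2 = {x}^2 + 2 x floor(x) - x^2. *)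
move: (Num.floor _)%:~R => f.
(* With the floor abstracted to [f], a rational-function identity remains; the closed form must grow
   by ((h+1)b/a)^2. Splitting the cast of [h.+1] leaves [h%:R] as the only atom in h, and [a_neq0]
   clears the denominators. *)
by rewrite -[h.+1]addn1 natrD; field.
Qed.
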